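(* For any positive odd integer $n$, we have $$\sum_{j,k=0}^{n-1}\frac{1}{\sin(2\pi j/n)+\cos(2\pi k/n)}=n^2,$$ $$\sum_{j,k=0}^{n-1}\frac{1}{\sin(\pi(2j+1)/n)+\cos(\pi(2k+1)/n)}=-n^2,$$ $$\sum_{j,k=0}^{n-1}\frac{1}{\cos(2\pi j/n)+\cos(2\pi k/n)}=\frac{n^2}{2},$$ $$\sum_{j,k=0}^{n-1}\frac{1}{\cos(\pi(2j+1)/n)+\cos(\pi(2k+1)/n)}=-\frac{n^2}{2}.$$
   Context: The sums over $j,k$ run over all pairs $(j,k)$ with $j,k\in\{0,\ldots,n-1\}$. *)

(* Defs.v *)
From mathcomp Require Export all_boot all_order all_algebra.
From mathcomp Require Export reals trigo.

Set Implicit Arguments.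
Unset Strict Implicit.
Unset Printing Implicit Defensive.

(* Main.v *)
(* Write x_j = 2 pi j / n with n = 2m + 1.  Substituting j -> 2j + k in Z/n,
   where 2 is invertible, and factoring
   cos (x_(2j+k) + a) + cos x_k = 2 cos (x_(j+k) + a/2) cos (x_j + a/2)
   turns the double sum of 1 / (cos (x_j + a) + cos x_k) into
   (sum_j 1 / cos (x_j + a/2))^2 / 2.  The secant sum equals
   (-1)^m n / cos (n a / 2): expand cos (n x) / cos x as a Dirichlet kernel and
   note that cos (n x) does not depend on j when x = x_j + a/2, while all
   nonconstant harmonics sum to 0.  The cosine case is a = 0, the sine case
   a = - pi / 2; as n is odd, pi (2j + 1) / n is x_i + pi with j = i + m, so
   the half-shifted sums are the opposites of the unshifted ones. *)

Require Import Defs.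
From mathcomp Require Import all_boot all_order all_algebra.
From mathcomp Require Import reals trigo.
From mathcomp Require Import ring.

Import Order.TTheory GRing.Theory Num.Theory.
Local Open Scope ring_scope.

Section PeriodicSums.
Variables (V : nmodType) (n : nat) (f : nat -> V).
Hypothesis f_per : forall i, f (i + n)%N = f i.

Lemma periodic_modn i : f (i %% n)%N = f i.
Proof.
rewrite {2}(divn_eq i n) addnC.
by elim: (i %/ n)%N => [|q IHq]; rewrite ?addn0 // mulSnr addnA f_per.
Qed.

(** Each unit shift drops the first term [f c] and appends [f (c + n)], which equals it. *)
Lemma sum_periodic_shift c : \sum_(i < n) f (i + c)%N = \sum_(i < n) f i.
Proof.
elim: c => [|c <-]; first by apply: eq_bigr => i _; rewrite addn0.
case: n f_per => [|k] fP; first by rewrite !big_ord0.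
rewrite big_ord_recr [RHS]big_ord_recl /= addrC add0n; congr (_ + _).
  by rewrite -[RHS]fP; congr f; rewrite addnS addnC -addnS.
by apply: eq_bigr => i _; congr f; rewrite /bump /= addnS.
Qed.

(** Multiplication by a unit [c] permutes the residues mod [n], and [f] depends only on the
    residue. *)
Lemma sum_periodic_mul c : coprime n c ->
  \sum_(i < n) f (c * i)%N = \sum_(i < n) f i.
Proof.
case: (posnP n) => [-> _|n_gt0 co_nc]; first by rewrite !big_ord0.
pose h (i : 'I_n) : 'I_n := Ordinal (ltn_pmod (c * i)%N n_gt0).
rewrite [RHS](reindex_inj (h := h)); last first.
  move=> i j /(congr1 val) /= /eqP; wlog le_ij : i j / (i <= j)%N.
    by move=> W e; case/orP: (leq_total i j) => ?; [|symmetry]; apply: W;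
       rewrite // eq_sym.
  rewrite eq_sym eqn_mod_dvd ?leq_mul2l ?le_ij ?orbT //.
  rewrite -mulnBr Gauss_dvdr //.
  move=> dv; apply/val_inj/eqP; rewrite eqn_leq le_ij /= -subn_eq0.
  apply: contraTT dv; rewrite -lt0n => lt_ij.
  by rewrite gtnNdvd // (leq_ltn_trans (leq_subr _ _)).
by apply: eq_bigr => i _; rewrite /= periodic_modn.
Qed.

End PeriodicSums.

Arguments sum_periodic_shift {V n f} f_per c.
Arguments sum_periodic_mul {V n f} f_per {c}.

Section Trigonometry.
Variable R : realType.
Implicit Types (x y a t d : R) (m n k : nat).

Lemma cosDn2pi x k : cos (x + 2 * pi * k%:R) = cos x.
Proof.
by rewrite mulr_natr mulr_natl (periodicn (@cosD2pi R)).
Qed.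

Lemma sinDn2pi x k : sin (x + 2 * pi * k%:R) = sin x.
Proof.
by rewrite mulr_natr mulr_natl (periodicn (@sinD2pi R)).
Qed.

Lemma cosDcos x y : cos (x + y) + cos (x - y) = 2 * cos x * cos y.
Proof. by rewrite cosD cosB; ring. Qed.

(** This is the Dirichlet kernel at [x + pi / 2], whence the alternating signs. Keeping [cos x] as a
    factor makes the identity valid at its zeros too. *)
Lemma cos_odd_Dirichlet x m :
  cos (m.*2.+1%:R * x) = (-1) ^+ m * cos x *
    (1 + 2 * \sum_(l < m) (-1) ^+ l.+1 * cos (l.+1.*2%:R * x)).
Proof.
elim: m => [|m IHm]; first by rewrite big_ord0 mul1r expr0; ring.
have := cosDcos (m.+1.*2%:R * x) x.
have -> : m.+1.*2%:R * x + x = m.+1.*2.+1%:R * x.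
  by rewrite -[m.+1.*2.+1]addn1 natrD; ring.
have -> : m.+1.*2%:R * x - x = m.*2.+1%:R * x.
  by rewrite doubleS -[m.*2.+2]addn1 natrD; ring.
rewrite IHm big_ord_recr /= exprS => /(canRL (addrK _)) ->.
have := sqrr_sign R m; set e := (-1) ^+ m => e2.
set S := \sum_(_ < _) _; set c := cos (_ * x).
(* The new harmonic carries the sign of [m.+1] twice, once from the prefactor and once from the sum;
   hence the factor [e ^+ 2 = 1]. *)
by transitivity (2 * (e ^+ 2) * c * cos x - e * cos x * (1 + 2 * S));
  [rewrite e2; ring | ring].
Qed.

(** Multiplied by [2 * sin (d / 2)], the sum telescopes into a difference of sines whose arguments
    differ by [d * n], a multiple of [2 * pi]. *)
Lemma sum_cos_arith a d n k : sin (d / 2) != 0 -> d * n%:R = 2 * pi * k%:R ->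
  \sum_(j < n) cos (a + d * j%:R) = 0.
Proof.
move=> d_neq0 dk; pose F j := sin (a - d / 2 + d * j%:R) / (2 * sin (d / 2)).
transitivity (\sum_(0 <= j < n) (F j.+1 - F j)).
  rewrite big_mkord; apply: eq_bigr => j _; rewrite /F -mulrBl.
  have -> : a - d / 2 + d * j.+1%:R = (a + d * j%:R) + d / 2.
    by rewrite -natr1; field.
  have -> : a - d / 2 + d * j%:R = (a + d * j%:R) - d / 2 by ring.
  by rewrite sinD sinB; field.
by rewrite GRing.telescope_sumr // /F dk sinDn2pi mulr0 addr0 subrr.
Qed.

Lemma sum_sec t m (n := m.*2.+1) : cos (n%:R * t) != 0 ->
  \sum_(j < n) (cos (2 * pi * j%:R / n%:R + t))^-1
    = (-1) ^+ m * n%:R / cos (n%:R * t).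
Proof.
move=> c_neq0; have n_neq0 : n%:R != 0 :> R by rewrite pnatr_eq0.
pose x (j : nat) := 2 * pi * j%:R / n%:R + t.
have secE j : (cos (x j))^-1 = (-1) ^+ m / cos (n%:R * t) *
    (1 + 2 * \sum_(l < m) (-1) ^+ l.+1 * cos (l.+1.*2%:R * x j)).
  have nx : cos (n%:R * x j) = cos (n%:R * t).
    by rewrite -[RHS](cosDn2pi _ j); congr cos; rewrite /x; field.
  have := cos_odd_Dirichlet (x j) m; rewrite nx => e.
  (* By the Dirichlet identity, a zero of [cos (x j)] would be a zero of [cos (n t)]. *)
  have cx_neq0 : cos (x j) != 0.
    by apply: contraNneq c_neq0 => cx0; rewrite e cx0 mulr0 mul0r.
  apply: (mulfI cx_neq0); rewrite divff //; set D := 1 + _ in e *.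
  by rewrite -{1}(divff c_neq0) {1}e; ring.
rewrite (eq_bigr _ (fun (j : 'I_n) _ => secE j)) -mulr_sumr big_split /= -mulr_sumr.
rewrite sumr_const card_ord exchange_big /= big1 ?mulr0 ?addr0 => [|l _].
  by rewrite mulrAC mulr_natr.
rewrite -mulr_sumr.
have := @sum_cos_arith (l.+1.*2%:R * t) (l.+1.*2%:R * (2 * pi) / n%:R) n l.+1.*2.
move=> S; rewrite (eq_bigr (fun j : 'I_n => cos (l.+1.*2%:R * t +
   l.+1.*2%:R * (2 * pi) / n%:R * j%:R))); last first.
  by move=> j _; congr cos; rewrite /x; field.
rewrite S ?mulr0 //; last by field.
(* Half the step is [pi * (2l + 2) / n] with [0 < 2l + 2 <= 2m < n], hence strictly between 0 and
   [pi]. *)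
apply/lt0r_neq0/sin_gt0_pi.
have -> : l.+1.*2%:R * (2 * pi) / n%:R / 2 = pi * (l.+1.*2%:R / n%:R) :> R.
  by field.
rewrite mulr_gt0 ?pi_gt0 ?divr_gt0 ?ltr0n //=.
by rewrite gtr_pMr ?pi_gt0 // ltr_pdivrMr ?ltr0n // mul1r ltr_nat ltnS leq_double.
Qed.

Lemma cos_period_div n a j : (0 < n)%N ->
  cos (2 * pi * (j + n)%:R / n%:R + a) = cos (2 * pi * j%:R / n%:R + a).
Proof.
move=> n_gt0; rewrite -[RHS](cosDn2pi _ 1); congr cos.
by rewrite natrD; field; rewrite pnatr_eq0 -lt0n.
Qed.

Lemma sum_inv_cosDcos a n : odd n -> 1 + cos (n%:R * a) != 0 ->
  \sum_(j < n) \sum_(k < n)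
     1 / (cos (2 * pi * j%:R / n%:R + a) + cos (2 * pi * k%:R / n%:R))
    = n%:R ^+ 2 / (1 + cos (n%:R * a)).
Proof.
move=> n_odd; rewrite -[n]odd_double_half n_odd add1n.
move: n./2 => {n n_odd} m; set n := m.*2.+1.
have n_neq0 : n%:R != 0 :> R by rewrite pnatr_eq0.
(* The half-angle formula turns the hypothesis into the one of [sum_sec] at [t = a / 2]. *)
have -> : 1 + cos (n%:R * a) = 2 * cos (n%:R * (a / 2)) ^+ 2.
  have -> : n%:R * a = (n%:R * (a / 2)) *+ 2 by rewrite -mulr_natr; field.
  by rewrite cos_mulr2n -mulr_natr; ring.
rewrite mulf_eq0 pnatr_eq0 sqrf_eq0 /= => c_neq0.
pose x (j : nat) : R := 2 * pi * j%:R / n%:R.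
pose g (j : nat) := (cos (x j + a / 2))^-1.
have g_per i : g (i + n)%N = g i by rewrite /g /x cos_period_div.
rewrite exchange_big /=.
transitivity (\sum_(k < n) \sum_(j < n) g (j + k)%N * g j / 2).
  apply: eq_bigr => k _.
  pose f (j : nat) := 1 / (cos (x j + a) + cos (x k)).
  have f_per i : f (i + n)%N = f i by rewrite /f /x cos_period_div.
  (* The substitution of [2j + k] for [j] is a shift by [k] followed by a doubling. *)
  rewrite -[LHS]/(\sum_(j < n) f j) -(sum_periodic_shift f_per k).
  have fk_per i : f (i + n + k)%N = f (i + k)%N by rewrite addnAC f_per.
  rewrite -(sum_periodic_mul fk_per (c := 2));
    last by rewrite coprimen2 /= odd_double.
  apply: eq_bigr => j _; rewrite /f /g.
  have -> : x (2 * j + k)%N + a = (x (j + k)%N + a / 2) + (x j + a / 2).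
    by rewrite /x (natrD _ (2 * j)) natrM (natrD _ j); field.
  have -> : x k = (x (j + k)%N + a / 2) - (x j + a / 2).
    by rewrite /x (natrD _ j); field.
  by rewrite cosDcos -mulrA div1r !invfM; ring.
rewrite exchange_big /=.
(* For fixed [j], shifting [k] by [j] decouples the two sums. *)
transitivity (\sum_(j < n) (\sum_(k < n) g k) * g j / 2).
  apply: eq_bigr => j _; rewrite -(sum_periodic_shift g_per j) -!mulr_suml.
  by congr (_ * _ / _); apply: eq_bigr => k _; rewrite addnC.
rewrite -mulr_suml -mulr_sumr (sum_sec _ _ c_neq0) -/n.
have := sqrr_sign R m; set e := (-1) ^+ m => e2.
transitivity (e ^+ 2 * n%:R ^+ 2 / (2 * cos (n%:R * (a / 2)) ^+ 2)); first by field.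
by rewrite e2 mul1r.
Qed.

(** [F] is arbitrary so that it can be a whole inner sum, as a function of the outer angle, or a
    single summand, as a function of the inner angle. *)
Lemma sum_half_shift (F : R -> R) n : odd n -> periodic F (pi *+ 2) ->
  \sum_(j < n) F (pi * (2 * j%:R + 1) / n%:R)
    = \sum_(j < n) F (2 * pi * j%:R / n%:R + pi).
Proof.
move=> n_odd F_per.
have n_neq0 : n%:R != 0 :> R by rewrite pnatr_eq0 -lt0n odd_gt0.
pose f (j : nat) := F (pi * (2 * j%:R + 1) / n%:R).
have f_per i : f (i + n)%N = f i.
  rewrite /f -[RHS]F_per -mulr_natr; congr F.
  by rewrite natrD; field.
rewrite -(sum_periodic_shift f_per n./2); apply: eq_bigr => j _; congr F.
have -> : n%:R = 1 + 2 * n./2%:R :> R.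
  by rewrite -{1}[n]odd_double_half n_odd natrD -muln2 natrM mulrC.
rewrite natrD; field.
by rewrite -natrM nat1r pnatr_eq0.
Qed.

End Trigonometry.

Arguments sum_inv_cosDcos {R} a {n}.
Arguments sum_half_shift {R} F {n}.

(* In each sum every denominator is nonzero, because n is odd. *)
Theorem corollary1p3 (R : realType) (n : nat) (n_gt0 : (0 < n)%N)
    (n_odd : odd n) :
  [/\ \sum_(j < n) \sum_(k < n)
        1 / (sin (2 * pi * j%:R / n%:R) + cos (2 * pi * k%:R / n%:R))
        = n%:R ^+ 2 :> R,
      \sum_(j < n) \sum_(k < n)
        1 / (sin (pi * (2 * j%:R + 1) / n%:R)
             + cos (pi * (2 * k%:R + 1) / n%:R))
        = - (n%:R ^+ 2) :> R,
      \sum_(j < n) \sum_(k < n)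
        1 / (cos (2 * pi * j%:R / n%:R) + cos (2 * pi * k%:R / n%:R))
        = n%:R ^+ 2 / 2 :> R
    & \sum_(j < n) \sum_(k < n)
        1 / (cos (pi * (2 * j%:R + 1) / n%:R)
             + cos (pi * (2 * k%:R + 1) / n%:R))
        = - (n%:R ^+ 2 / 2) :> R].
Proof.
have sin_sum : \sum_(j < n) \sum_(k < n)
    1 / (sin (2 * pi * j%:R / n%:R) + cos (2 * pi * k%:R / n%:R))
    = n%:R ^+ 2 :> R.
  (* An odd multiple of [pi / 2] is a zero of the cosine, so the denominator [1 + cos (n a)] is
     1. *)
  have cos_na : cos (n%:R * (- (pi / 2))) = 0 :> R.
    rewrite mulrN cosN -{1}[n]odd_double_half n_odd.
    have -> : (1 + n./2.*2)%:R * (pi / 2) = pi / 2 + pi *+ n./2 :> R.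
      by rewrite natrD -muln2 natrM -mulr_natr; field.
    by rewrite (alternatingn (@cosDpi R)) cos_pihalf mulr0.
  have := sum_inv_cosDcos (- (pi / 2) : R) n_odd.
  rewrite cos_na addr0 divr1 => <-; last exact: oner_neq0.
  by apply: eq_bigr => j _; apply: eq_bigr => k _; rewrite cosBpihalf.
have cos_sum : \sum_(j < n) \sum_(k < n)
    1 / (cos (2 * pi * j%:R / n%:R) + cos (2 * pi * k%:R / n%:R))
    = n%:R ^+ 2 / 2 :> R.
  have := sum_inv_cosDcos (0 : R) n_odd.
  rewrite mulr0 cos0 (_ : 1 + 1 = 2) // => <-; last by rewrite pnatr_eq0.
  by apply: eq_bigr => j _; apply: eq_bigr => k _; rewrite addr0.
(* With [F] either [sin] or [cos], adding [pi] to both angles negates every denominator. *)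
have shifted (F : R -> R) : alternating F pi -> periodic F (pi *+ 2) ->
    \sum_(j < n) \sum_(k < n) 1 / (F (pi * (2 * j%:R + 1) / n%:R)
                                   + cos (pi * (2 * k%:R + 1) / n%:R))
    = - \sum_(j < n) \sum_(k < n) 1 / (F (2 * pi * j%:R / n%:R)
                                   + cos (2 * pi * k%:R / n%:R)).
  move=> F_alt F_per.
  rewrite (sum_half_shift (fun y => \sum_(k < n)
     1 / (F y + cos (pi * (2 * k%:R + 1) / n%:R)))) //; last first.
    by move=> y; apply: eq_bigr => k _; rewrite F_per.
  rewrite -sumrN; apply: eq_bigr => j _.
  rewrite (sum_half_shift (fun y =>
     1 / (F (2 * pi * j%:R / n%:R + pi) + cos y))) //; last first.
    by move=> y; rewrite cosD2pi.
  rewrite -sumrN; apply: eq_bigr => k _.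
  by rewrite F_alt cosDpi -opprD invrN mulrN.
split=> //.
  by rewrite (shifted _ (@sinDpi R) (@sinD2pi R)) sin_sum.
by rewrite (shifted _ (@cosDpi R) (@cosD2pi R)) cos_sum.
Qed.
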